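(* Let $0<\rho<1$, let $m$ be a positive integer, and let $Q^m:\sigma_\rho\to\sigma_\rho$ be the $m$th power operator $Q^m(x)=\{t_n^m\}_{n=1}^\infty$ for $x=\{t_n\}_{n=1}^\infty\in\sigma_\rho$. Then $Q^m$ is Fréchet differentiable on $\sigma_\rho$, and for every $\bar x=(\bar t_1,\bar t_2,\ldots)\in\sigma_\rho$ its Fréchet derivative $\nabla(Q^m)(\bar x)$ at $\bar x$ is given as follows. (i) If $m>1$, then $\nabla(Q^m)(\bar x)$ is the infinite diagonal matrix with diagonal entries $m\bar t_1^{\,m-1},m\bar t_2^{\,m-1},\ldots$, i.e. the pointwise multiplication operator on $\sigma_\rho$ with $\nabla(Q^m)(\bar x)(x)=\{m\bar t_n^{\,m-1}t_n\}_{n=1}^\infty\in\sigma_\rho$ for every $x=\{t_n\}_{n=1}^\infty\in\sigma_\rho$. (ii) If $m=1$, then $\nabla(Q)(\bar x)$ (with $Q=Q^1$) is the infinite identity matrix, i.e. $\nabla(Q)(\bar x)(x)=x$ for every $x\in\sigma_\rho$.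
   Context: $\sigma_\rho$ is the real vector space of all real sequences $\{t_n\}_{n=1}^\infty$ with $\sum_{n=1}^\infty|t_n|^\rho<\infty$. For $k=1,2,\ldots$ define the $F$-seminorm $\|x\|_{\rho,k}=|t_k|^\rho$ for $x=\{t_n\}_{n=1}^\infty\in\sigma_\rho$. $\sigma_\rho$ carries the topology $\tau_\rho$ induced by the family $\mathbb{F}_{\sigma_\rho}=\{\|\cdot\|_{\rho,k}:k=1,2,\ldots\}$, i.e. the sets $\{x:\max\{p(x-x_0):p\in I\}<\lambda\}$, with $I$ a nonempty finite subset of $\mathbb{F}_{\sigma_\rho}$ and $\lambda>0$, form a base of neighborhoods of $x_0$. $\mathcal{F}_{\sigma_\rho}$ is the collection of nonempty finite subsets of $\mathbb{F}_{\sigma_\rho}$. Fréchet differentiability is with respect to this family: for $T:\sigma_\rho\to\sigma_\rho$ and $\bar x\in\sigma_\rho$, $T$ is Fréchet differentiable at $\bar x$ with Fréchet derivative $\nabla T(\bar x)=A$ if $A:\sigma_\rho\to\sigma_\rho$ is a continuous linear mapping such that for every $J\in\mathcal{F}_{\sigma_\rho}$ and $\varepsilon>0$ there are $I\in\mathcal{F}_{\sigma_\rho}$ and $\delta>0$ such that for all $u\in\sigma_\rho$: (DZ) if $\max\{p(u):p\in I\}=0$ then $\max\{q(T(\bar x+u)-T(\bar x)-A(u)):q\in J\}=0$; and (DR) if $0<\max\{p(u):p\in I\}<\delta$ then $\max\left\{q\left(\frac{T(\bar x+u)-T(\bar x)-A(u)}{\max\{p(u):p\in I\}}\right):q\in J\right\}<\varepsilon$.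 The equation $\nabla T(\bar x)=A$ is the assertion that $A$ has these properties. *)

(* Defs.v *)
From HB Require Import structures.
From mathcomp Require Import all_boot all_order all_algebra finmap.
From mathcomp Require Import all_classical all_reals all_analysis.

Set Implicit Arguments.
Unset Strict Implicit.
Unset Printing Implicit Defensive.

Import Order.TTheory GRing.Theory Num.Theory.
Import numFieldNormedType.Exports.

Local Open Scope classical_set_scope.
Local Open Scope ring_scope.

Lemma powR_normD (R : realType) (rho x y : R) : 0 < rho < 1 ->
  `|x + y| `^ rho <= `|x| `^ rho + `|y| `^ rho.
Proof.
case/andP=> r0 r1.
apply: (@le_trans _ _ ((`|x| + `|y|) `^ rho)).
  apply: ge0_ler_powR; rewrite ?nnegrE ?addr_ge0//; first exact: ltW.
  exact: ler_normD.
have [/eqP|n0] := eqVneq (`|x| + `|y|) 0.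
  rewrite paddr_eq0// => /andP[/eqP-> /eqP->].
  by rewrite addr0 powR0 ?gt_eqF// addr0.
set s := `|x| + `|y|.
have s0 : 0 < s by rewrite lt_def n0 addr_ge0.
have key (a : R) : 0 <= a -> a <= s -> a / s * s `^ rho <= a `^ rho.
  move=> a0 as_.
  have -> : a `^ rho = (a / s) `^ rho * s `^ rho.
    by rewrite -powRM ?divr_ge0 ?(ltW s0)// divfK// gt_eqF.
  apply: ler_wpM2r; first exact: powR_ge0.
  have [->|an0] := eqVneq a 0; first by rewrite mul0r powR_ge0.
  apply: ger1_powR; last exact: ltW.
  by rewrite ler_pdivrMr// mul1r as_ andbT divr_gt0// lt_def an0.
apply: le_trans (lerD (key _ (normr_ge0 x) _) (key _ (normr_ge0 y) _)).
- by rewrite -mulrDl -mulrDl mulfV ?mul1r// gt_eqF.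
- by rewrite /s lerDl.
- by rewrite /s lerDr.
Qed.

Definition sigma_pred (R : realType) (rho : R) (hrho : 0 < rho < 1) :
    {pred nat -> R} :=
  fun t => (\sum_(0 <= n <oo) (`|t n| `^ rho)%:E < +oo)%E.

Lemma sigma_pred_submod (R : realType) (rho : R) (hrho : 0 < rho < 1) :
  GRing.subsemimod_closed (sigma_pred hrho).
Proof.
have /andP[r0 _] := hrho.
have ge0 (t : nat -> R) n : (0 <= (`|t n| `^ rho)%:E)%E.
  by rewrite lee_fin powR_ge0.
split; first split=> [|t u].
- rewrite unfold_in /sigma_pred eseries0 ?ltry// => n _ _.
  by rewrite normr0 powR0 ?gt_eqF.
- rewrite !unfold_in /sigma_pred => ht hu.
  have := lte_add_pinfty ht hu; rewrite -nneseriesD//; apply: le_lt_trans.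
  apply: lee_nneseries => [n _ _|n _]; first exact: (ge0 (t + u)).
  by rewrite -EFinD lee_fin; exact: powR_normD.
- move=> a t; rewrite !unfold_in /sigma_pred => ht.
  rewrite (eq_eseriesr (g := fun n =>
    ((`|a| `^ rho)%:E * (`|t n| `^ rho)%:E)%E)) => [|n _]; last first.
    by rewrite /= normrM powRM ?EFinM.
  rewrite nneseriesZl//; exact: lte_mul_pinfty.
Qed.

HB.instance Definition _ (R : realType) (rho : R) (hrho : 0 < rho < 1) :=
  GRing.isSubmodClosed.Build R (nat -> R) (sigma_pred hrho)
    (sigma_pred_submod hrho).

(* The term t_n of the sequence is [x n.-1]: indices are shifted to start
   at 0.  The bound on rho is a parameter of the type because sigma_rho need
   not be a vector space without it. *)
Record sigma (R : realType) (rho : R) (hrho : 0 < rho < 1) := Sigma {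
  sigma_val :> nat -> R;
  _ : sigma_val \in sigma_pred hrho }.

HB.instance Definition _ (R : realType) (rho : R) (hrho : 0 < rho < 1) :=
  [isSub for @sigma_val R rho hrho].
HB.instance Definition _ (R : realType) (rho : R) (hrho : 0 < rho < 1) :=
  [Choice of sigma hrho by <:].
HB.instance Definition _ (R : realType) (rho : R) (hrho : 0 < rho < 1) :=
  [SubChoice_isSubLmodule of sigma hrho by <:].

Definition fseminorm (R : realType) (rho : R) (hrho : 0 < rho < 1)
  (k : nat) (x : sigma hrho) : R := `|x k| `^ rho.

Definition fseminorms (R : realType) (rho : R) (hrho : 0 < rho < 1) :
    set (sigma hrho -> R) :=
  range (@fseminorm R rho hrho).
Arguments fseminorms {R rho} hrho _ : rename.

Definition finite_subfamilies (R : realType) (rho : R) (hrho : 0 < rho < 1) :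
    set {fset (sigma hrho -> R)} :=
  [set I | I != fset0 /\ [set` I] `<=` fseminorms hrho].
Arguments finite_subfamilies {R rho} hrho _ : rename.

(* F-seminorms are nonnegative, so on a nonempty family the starting value 0
   does not affect the maximum. *)
Definition fmax (R : realType) (X : Type) (I : {fset (X -> R)}) (u : X) : R :=
  \big[Num.max/0]_(p <- I) p u.

Definition sigma_nbhs (R : realType) (rho : R) (hrho : 0 < rho < 1)
    (x0 : sigma hrho) : set_system (sigma hrho) :=
  filter_from
    [set Il : {fset (sigma hrho -> R)} * R |
      finite_subfamilies hrho Il.1 /\ 0 < Il.2]
    (fun Il => [set x | fmax Il.1 (x - x0) < Il.2]).

Lemma fmax_lt (R : realType) (X : Type) (I : {fset (X -> R)}) (u : X)
    (e : R) : 0 < e -> (forall p, p \in I -> p u < e) <-> fmax I u < e.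
Proof.
move=> e0; rewrite /fmax; split=> [h|].
  rewrite big_seq; elim/big_ind: _ => // a b ha hb.
  by rewrite gt_max ha hb.
move=> h p pI; apply: le_lt_trans h.
by apply: (le_bigmax_seq 0 p xpredT (fun p => p u)).
Qed.

Lemma fseminorm0 (R : realType) (rho : R) (hrho : 0 < rho < 1)
    (p : sigma hrho -> R) : fseminorms hrho p -> p 0 = 0.
Proof.
have /andP[r0 _] := hrho.
by case=> k _ <-; rewrite /fseminorm normr0 powR0 ?gt_eqF.
Qed.

Lemma fseminormD (R : realType) (rho : R) (hrho : 0 < rho < 1)
    (p : sigma hrho -> R) (x y : sigma hrho) :
  fseminorms hrho p -> p (x + y) <= p x + p y.
Proof. by case=> k _ <-; exact: powR_normD. Qed.

Lemma sigma_nbhs_filter (R : realType) (rho : R) (hrho : 0 < rho < 1)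
    (x : sigma hrho) : ProperFilter (sigma_nbhs x).
Proof.
apply: filter_from_proper; last first.
  move=> [I l] /= [[_ IF] l0]; exists x => /=; rewrite subrr.
  by apply/fmax_lt => // p /IF /fseminorm0 ->.
apply: filter_from_filter.
  exists ([fset (fseminorm 0 : sigma hrho -> R)]%fset, 1); split=> //; split.
    by apply/fset0Pn; exists (fseminorm 0); rewrite inE.
  by move=> p /=; rewrite inE => /eqP ->; exists 0%N.
move=> [I l] [J m] /= [[I0 IF] l0] [[J0 JF] m0].
exists ((I `|` J)%fset, Num.min l m) => /=.
  split; last by rewrite lt_min l0.
  split; first by rewrite fsetU_eq0 negb_and I0.
  by move=> p /=; rewrite in_fsetU => /orP[/IF|/JF].
have lm0 : 0 < Num.min l m by rewrite lt_min l0.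
move=> y /= /fmax_lt -/(_ lm0) h; split; apply/fmax_lt => // p pI;
  have := h p; rewrite in_fsetU pI ?orbT lt_min => /(_ isT)/andP[] //.
Qed.

Lemma sigma_nbhs_singleton (R : realType) (rho : R) (hrho : 0 < rho < 1)
    (x : sigma hrho) (A : set (sigma hrho)) : sigma_nbhs x A -> A x.
Proof.
move=> [[I l] /= [[_ IF] l0]]; apply => /=; rewrite subrr.
by apply/fmax_lt => // p /IF /fseminorm0 ->.
Qed.

Lemma sigma_nbhs_nbhs (R : realType) (rho : R) (hrho : 0 < rho < 1)
    (x : sigma hrho) (A : set (sigma hrho)) :
  sigma_nbhs x A -> sigma_nbhs x ((@sigma_nbhs R rho hrho)^~ A).
Proof.
move=> [[I l] /= [IF l0] h].
have l20 : 0 < l / 2 by rewrite divr_gt0.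
exists (I, l / 2) => //= y /= /fmax_lt -/(_ l20) yx.
exists (I, l / 2) => //= z /= /fmax_lt -/(_ l20) zy; apply: h => /=.
apply/fmax_lt => // p pI.
rewrite -(subrK y z) -addrA [l]splitr.
apply: le_lt_trans (ltrD (zy p pI) (yx p pI)).
by apply: fseminormD; exact: IF.2.
Qed.

HB.instance Definition _ (R : realType) (rho : R) (hrho : 0 < rho < 1) :=
  hasNbhs.Build (sigma hrho) (@sigma_nbhs R rho hrho).
HB.instance Definition _ (R : realType) (rho : R) (hrho : 0 < rho < 1) :=
  Nbhs_isNbhsTopological.Build (sigma hrho)
    (@sigma_nbhs_filter R rho hrho) (@sigma_nbhs_singleton R rho hrho)
    (@sigma_nbhs_nbhs R rho hrho).

Definition is_frechet_derivative (R : realType) (rho : R)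
    (hrho : 0 < rho < 1) (T : sigma hrho -> sigma hrho) (x : sigma hrho)
    (A : sigma hrho -> sigma hrho) : Prop :=
  [/\ linear A, continuous A &
    forall J (eps : R), finite_subfamilies hrho J -> 0 < eps ->
    exists I (delta : R), [/\ finite_subfamilies hrho I, 0 < delta &
      forall u : sigma hrho,
        (fmax I u = 0 -> fmax J (T (x + u) - T x - A u) = 0) /\
        (0 < fmax I u < delta ->
          fmax J ((fmax I u)^-1 *: (T (x + u) - T x - A u)) < eps)]].

Definition frechet_differentiable (R : realType) (rho : R)
    (hrho : 0 < rho < 1) (T : sigma hrho -> sigma hrho) (x : sigma hrho) :
    Prop :=
  exists A, is_frechet_derivative T x A.

(* A is the infinite diagonal matrix with diagonal entries d. *)
Definition is_diagonal_operator (R : realType) (rho : R)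
    (hrho : 0 < rho < 1) (d : nat -> R) (A : sigma hrho -> sigma hrho) :
    Prop :=
  forall (x : sigma hrho) n, A x n = d n * x n.

Lemma sigma_pred_exp (R : realType) (rho : R) (hrho : 0 < rho < 1)
    (m : nat) (hm : (0 < m)%N) (x : sigma hrho) :
  (fun n => x n ^+ m) \in sigma_pred hrho.
Proof.
case: x => t /=; rewrite !unfold_in /sigma_pred; set S := (X in (X < _)%E).
have ge0 n : (0 <= (`|t n| `^ rho)%:E)%E by rewrite lee_fin powR_ge0.
move=> Soo.
have S0 : (0 <= S)%E by exact: nneseries_ge0.
have Sfin : S \is a fin_num by rewrite ge0_fin_numE.
have tS n : `|t n| `^ rho <= fine S.
  rewrite -lee_fin fineK// /S (@nneseriesD1 _ _ n)// leeDl//.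
  by apply: nneseries_ge0.
case: m hm => // m _.
apply: (@le_lt_trans _ _ ((fine S ^+ m)%:E * S)%E); last first.
  by apply: lte_mul_pinfty => //; rewrite lee_fin exprn_ge0// fine_ge0.
rewrite /S -nneseriesZl//; apply: lee_nneseries => [n _ _|n _].
  by rewrite lee_fin powR_ge0.
rewrite -EFinM lee_fin normrX -powR_mulrn// powRAC powR_mulrn ?powR_ge0//.
rewrite exprSr ler_wpM2r ?powR_ge0// lerXn2r// nnegrE ?powR_ge0//.
exact: fine_ge0.
Qed.

Definition power_op (R : realType) (rho : R) (hrho : 0 < rho < 1)
    (m : nat) (hm : (0 < m)%N) (x : sigma hrho) : sigma hrho :=
  Sigma (sigma_pred_exp hm x).

(* Main.v *)
(** The difference quotient is controlled coordinatewise by the Taylor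
    remainder of [t ^+ m], which is at most [C * b ^+ 2] for an increment [b]
    with [`|b| <= 1], where [C] does not depend on the coordinate because
    elements of [sigma] are bounded sequences.  Since [rho < 1], one has
    [`|b| <= `|b| `^ rho] for [`|b| <= 1]; so, with [M = fmax J u < 1],
    dividing the remainder by [M] leaves at most [C * M], and the choice
    [I = J] works. *)
Require Import Defs.
From mathcomp Require Import all_boot all_order all_algebra finmap.
From mathcomp Require Import all_classical all_reals all_analysis.
From mathcomp Require Import ring.

Import Order.TTheory GRing.Theory Num.Theory.
Local Open Scope ring_scope.

(** By induction: the next remainder is [a + b] times the previous one plus
    [m.+1%:R * a ^+ m * b ^+ 2], and [a + b] is bounded by [B + 1]. Positivity of [C] is kept so
    that one can later divide by it. *)
Lemma expr_taylor1_remainder {R : realFieldType} {B : R} (m : nat) : 0 <= B ->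
  exists2 C : R, 0 < C & forall a b : R, `|a| <= B -> `|b| <= 1 ->
    `|(a + b) ^+ m.+1 - a ^+ m.+1 - m.+1%:R * a ^+ m * b| <= C * `|b| ^+ 2.
Proof.
move=> B0; elim: m => [|m [C C0 IH]].
  exists 1 => // a b _ _.
  have -> : (a + b) ^+ 1 - a ^+ 1 - 1%:R * a ^+ 0 * b = 0 by ring.
  by rewrite normr0 mul1r exprn_ge0.
exists ((B + 1) * C + m.+1%:R * B ^+ m) => [|a b aB b1].
  by rewrite ltr_wpDr ?mulr_ge0 ?exprn_ge0// mulr_gt0// ltr_wpDl.
have -> : (a + b) ^+ m.+2 - a ^+ m.+2 - m.+2%:R * a ^+ m.+1 * b =
    (a + b) * ((a + b) ^+ m.+1 - a ^+ m.+1 - m.+1%:R * a ^+ m * b) +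
    m.+1%:R * a ^+ m * b ^+ 2.
  by rewrite !exprS -[m.+2%:R]natr1; ring.
apply: le_trans (ler_normD _ _) _; rewrite [leRHS]mulrDl; apply: lerD.
  rewrite normrM -[leRHS]mulrA; apply: ler_pM => //; last exact: IH.
  by apply: le_trans (ler_normD _ _) _; exact: lerD.
rewrite !normrM !normrX normr_nat ler_wpM2r ?exprn_ge0//.
by rewrite ler_wpM2l// lerXn2r ?nnegrE.
Qed.

Lemma powR_le_inv {R : realType} {r a b : R} : 0 < r -> 0 <= a -> 0 <= b ->
  a `^ r <= b -> a <= b `^ r^-1.
Proof.
move=> r0 a0 b0 ab; rewrite -[a]powRr1// -(mulfV (lt0r_neq0 r0)) powRrM.
by apply: ge0_ler_powR; rewrite ?nnegrE ?powR_ge0 ?invr_ge0 ?(ltW r0).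
Qed.

Lemma fmax_ge {R : realType} {X : Type} {I : {fset (X -> R)}} (u : X) {p} :
  p \in I -> p u <= fmax I u.
Proof. by move=> pI; apply: (le_bigmax_seq 0 p xpredT (fun p => p u)). Qed.

Section sigma_rho.
Context {R : realType} {rho : R} {hrho : 0 < rho < 1}.
Implicit Types x u : sigma hrho.

Let rho_gt0 : 0 < rho. Proof. by have /andP[] := hrho. Qed.

(** A single term of the series of nonnegative terms is at most its sum [S], so [S] to the power
    [rho^-1] is a bound. *)
Lemma sigma_bounded x : exists2 B : R, 0 <= B & forall n, `|x n| <= B.
Proof.
case: x => t /=; rewrite unfold_in /sigma_pred; set S := (X in (X < _)%E).
move=> Soo.
have ge0 n : (0 <= (`|t n| `^ rho)%:E)%E by rewrite lee_fin powR_ge0.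
have S0 : (0 <= S)%E by exact: nneseries_ge0.
have Sfin : S \is a fin_num by rewrite ge0_fin_numE.
exists (fine S `^ rho^-1) => [|n]; first exact: powR_ge0.
apply: powR_le_inv; rewrite ?fine_ge0//.
rewrite -lee_fin fineK// /S (@nneseriesD1 _ _ n)// leeDl//.
exact: nneseries_ge0.
Qed.

Lemma sigma_pred_mul {d : nat -> R} {D : R} (hd : forall n, `|d n| <= D) x :
  (fun n => d n * x n) \in sigma_pred hrho.
Proof.
case: x => t /=; rewrite !unfold_in /sigma_pred => Soo.
have D0 : 0 <= D := le_trans (normr_ge0 _) (hd 0%N).
have ge0 n : (0 <= (`|t n| `^ rho)%:E)%E by rewrite lee_fin powR_ge0.
apply: (@le_lt_trans _ _
    ((D `^ rho)%:E * \sum_(0 <= n <oo) (`|t n| `^ rho)%:E)%E); last first.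
  by apply: lte_mul_pinfty => //; rewrite lee_fin powR_ge0.
rewrite -nneseriesZl//.
apply: lee_nneseries => [n _ _|n _]; first by rewrite lee_fin powR_ge0.
rewrite -EFinM lee_fin normrM powRM// ler_wpM2r ?powR_ge0//.
by apply: ge0_ler_powR; rewrite ?nnegrE ?(ltW rho_gt0).
Qed.

(** The bound on [d] is an argument because multiplication by an unbounded sequence can leave
    [sigma]. *)
Definition mul_op {d : nat -> R} {D : R} (hd : forall n, `|d n| <= D) x :
  sigma hrho := Sigma (sigma_pred_mul hd x).

Lemma mul_op_linear (d : nat -> R) (D : R) (hd : forall n, `|d n| <= D) :
  linear (mul_op hd).
Proof.
move=> a x u; apply: val_inj; apply/funext => n /=.
by rewrite [RHS](_ : _ = a * (d n * x n) + d n * u n)// mulrCA -mulrDr.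
Qed.

Lemma mul_op_continuous (d : nat -> R) (D : R) (hd : forall n, `|d n| <= D) :
  continuous (mul_op hd).
Proof.
move=> x A [[I l] /= [IF l0] h].
(* Adding 1 keeps the divisor positive when [D] is 0. *)
have D0 : 0 < D `^ rho + 1 by rewrite ltr_wpDl ?powR_ge0.
have lD0 : 0 < l / (D `^ rho + 1) by exact: divr_gt0.
exists (I, l / (D `^ rho + 1)) => //= y /= /fmax_lt -/(_ lD0) yx.
apply: h => /=; apply/fmax_lt => // p pI.
have := yx p pI; have [k _ <-] := IF.2 p pI.
rewrite ltr_pdivlMr// => /le_lt_trans; apply.
rewrite /fseminorm /= -mulrBr normrM powRM// mulrC.
apply: ler_wpM2l; first exact: powR_ge0.
apply: ler_wpDr => //; apply: ge0_ler_powR; rewrite ?nnegrE ?(ltW rho_gt0)//.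
exact: le_trans (hd 0%N).
Qed.

Lemma power_op_frechet {m : nat} (hm : (0 < m)%N) x :
  exists2 A : sigma hrho -> sigma hrho,
    is_diagonal_operator (fun n => m%:R * x n ^+ (m - 1)) A
    & is_frechet_derivative (power_op hm) x A.
Proof.
case: m hm => // m hm; rewrite subn1 /=.
have [B B0 xB] := sigma_bounded x.
have hd n : `|m.+1%:R * x n ^+ m| <= m.+1%:R * B ^+ m.
  by rewrite normrM normrX normr_nat ler_wpM2l// lerXn2r ?nnegrE.
exists (mul_op hd) => //; split.
- exact: mul_op_linear.
- exact: mul_op_continuous.
move=> J eps JF eps0.
have [C C0 rem] := expr_taylor1_remainder m B0.
have e0 : 0 < eps `^ rho^-1 by exact: powR_gt0.
(* The bound 1 gives []|u k| <= M [; the other gives] C * M < eps [^ rho^-1], the exponent undoing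
   the power [rho] in the F-seminorms. *)
exists J, (Num.min 1 (eps `^ rho^-1 / C)); split=> //.
  by rewrite lt_min ltr01 divr_gt0.
move=> u.
have coord k : power_op hm (x + u) k - power_op hm x k - mul_op hd u k =
  (x k + u k) ^+ m.+1 - x k ^+ m.+1 - m.+1%:R * x k ^+ m * u k by [].
split=> [M0|/andP[M_gt0]].
  (* For (DZ), a zero maximum forces [u k = 0] at every index [k] occurring in [J], and there the
     remainder vanishes. *)
  rewrite /fmax big_seq; elim/big_ind: _ => [//|a b -> ->|p pJ].
    by rewrite maxxx.
  have := fmax_ge u pJ; rewrite M0; have [k _ <-] := JF.2 p pJ.
  rewrite /fseminorm => uk.
  have /eqP : `|u k| `^ rho = 0 by apply/le_anti; rewrite uk powR_ge0.
  rewrite powR_eq0 normr_eq0 => /andP[/eqP uk0 _].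
  have := coord k; rewrite uk0 addr0 subrr mulr0 subr0 => e.
  by rewrite [X in `|X|]e normr0 powR0 ?gt_eqF.
set M := fmax J u in M_gt0 *.
rewrite lt_min => /andP[M1 MC]; apply/fmax_lt => // p pJ.
have := fmax_ge u pJ; rewrite -/M; have [k _ <-] := JF.2 p pJ.
rewrite /fseminorm => ukM.
have uM : `|u k| <= M.
  have u1 : `|u k| <= 1.
    have := powR_le_inv rho_gt0 (normr_ge0 _) ler01 (le_trans ukM (ltW M1)).
    by rewrite powR1.
  (* Comparing powers with exponents [rho] and 1 requires a positive base, so zero is treated
     apart. *)
  have [->|u0] := eqVneq `|u k| 0; first exact: ltW.
  apply: le_trans ukM; rewrite -{1}[ `|u k| ]powRr1//.
  apply: ger_powR; first by rewrite lt_def u0 normr_ge0.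
  by have /andP[_ /ltW] := hrho.
have r_le := rem (x k) (u k) (xB k) (le_trans uM (ltW M1)).
(* With [eps] written as a [rho]-th power, it suffices to compare the bases. *)
have epsE : eps = (eps `^ rho^-1) `^ rho.
  by rewrite -powRrM mulVf ?powRr1 ?ltW// lt0r_neq0.
rewrite [ltRHS]epsE.
apply: gt0_ltr_powR => //; rewrite ?nnegrE ?powR_ge0//.
rewrite [X in `|X|](_ : _ = M^-1 * ((x k + u k) ^+ m.+1 - x k ^+ m.+1 -
  m.+1%:R * x k ^+ m * u k))//.
rewrite normrM normfV (gtr0_norm M_gt0) mulrC ltr_pdivrMr//.
apply: le_lt_trans r_le _; apply: (@le_lt_trans _ _ (C * M ^+ 2)).
  by rewrite ler_pM2l// lerXn2r ?nnegrE// ltW.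
by rewrite expr2 mulrA ltr_pM2r// mulrC -ltr_pdivlMr.
Qed.

End sigma_rho.

Theorem theorem6p4 (R : realType) (rho : R) (hrho : 0 < rho < 1)
    (m : nat) (hm : (0 < m)%N) :
  let Q : sigma hrho -> sigma hrho := power_op hm in
  [/\ forall x : sigma hrho, frechet_differentiable Q x,
      (1 < m)%N -> forall x : sigma hrho,
        exists2 A : sigma hrho -> sigma hrho,
          is_diagonal_operator (fun n => m%:R * x n ^+ (m - 1)) A
          & is_frechet_derivative Q x A
    & m = 1%N -> forall x : sigma hrho, is_frechet_derivative Q x idfun].
Proof.
move=> Q; split=> [x|_ x|m1 x]; last 2 first.
- exact: power_op_frechet.
- have [A dA QA] := power_op_frechet hm x.
  (* For [m = 1] every diagonal entry is [1 * x n ^+ 0], which is 1 even where [x n = 0]. *)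
  suff <- : A = idfun by [].
  apply/funext => u; apply: val_inj; apply/funext => n.
  by rewrite /= dA m1 expr0 !mul1r.
by have [A _ QA] := power_op_frechet hm x; exists A.
Qed.
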